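(* Let $M,N$ be Kobayashi hyperbolic complex manifolds and let $\pi:M\to N$ be a holomorphic covering map. Then $\pi^*\kappa_N=\kappa_M$, i.e. $\kappa_N(\pi'(p)v,\pi'(p)w)=\kappa_M(v,w)$ for all $p\in M$ and $v,w\in\mathbf{T}_pM$.
   Context: Complex Binet-Legendre construction. Let $V$ be a complex vector space of dimension $n\geq 1$, $F$ a norm on $V$, and $\Omega_F=\{v\in V: F(v)<1\}$. On the complex dual $V^*=\mathrm{Hom}_{\mathbb{C}}(V,\mathbb{C})$ define the Hermitian inner product $$\mathfrak{g}_F^*(\theta,\phi)=\frac{n+1}{|\Omega_F|}\int_{\Omega_F}\theta(\eta)\overline{\phi(\eta)}\,d\eta,$$ where $d\eta$ is any Haar measure on $(V,+)$ and $|\Omega_F|$ is the measure of $\Omega_F$ (the result does not depend on the choice of Haar measure). $\mathfrak{g}_F:V\times V\to\mathbb{C}$ is the dual Hermitian inner product: for $v\in V$ let $\mu(v)\in V^*$ be the unique element with $\mathfrak{g}_F^*(\phi,\mu(v))=\phi(v)$ for all $\phi\in V^*$, and set $\mathfrak{g}_F(v,w)=\mathfrak{g}_F^*(\mu(w),\mu(v))$ (linear in $v$, conjugate-linear in $w$). Kobayashi metrics. Let $M$ be a complex manifold, $\mathbf{T}_pM$ its holomorphic tangent space at $p$, $\Delta\subset\mathbb{C}$ the unit disc. The Kobayashi(-Royden) pseudometric is, for $v\in\mathbf{T}_pM$, $$k_M(v)=\inf\{1/\lambda : \lambda>0,\ \text{there is a holomorphic } f:\Delta\to M \text{ with } f(0)=p,\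 f'(0)=\lambda v\}.$$ $M$ is Kobayashi hyperbolic if $k_M$ is locally bounded below by a positive constant: every point of $M$ has a neighbourhood $U$, with a continuous Hermitian norm $\|\cdot\|$ on the holomorphic tangent spaces at points of $U$, and a constant $C>0$ such that $k_M(v)\ge C\|v\|$ for all $q\in U$, $v\in\mathbf{T}_qM$. The Kobayashi-Busemann (pseudo)metric is, for $v\in\mathbf{T}_pM$, $\hat{k}_M(v)=\inf\{t>0: t^{-1}v\in\hat\Omega_{M,p}\}$, where $\hat\Omega_{M,p}$ is the convex hull of $\Omega_{M,p}=\{v\in\mathbf{T}_pM: k_M(v)<1\}$. When $M$ is Kobayashi hyperbolic, $\hat{k}_M$ restricts to a norm on each $\mathbf{T}_pM$, and the Hermitian metric $\kappa_M$ is defined by $\kappa_M(v,w)=\mathfrak{g}_{\hat{k}_M|_{\mathbf{T}_pM}}(v,w)$ for $p\in M$, $v,w\in\mathbf{T}_pM$. (A Hermitian metric here is an assignment of a positive definite Hermitian inner product to each $\mathbf{T}_pM$.) *)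

(* Defs.v *)
(* Complex numbers are R[i] for a realType R; C^n is the space of row vectors
   'rV[R[i]]_n with its (unique) vector space topology. *)
From HB Require Import structures.
From mathcomp Require Import all_boot all_order all_algebra.
From mathcomp Require Import all_classical all_reals all_analysis.
From mathcomp Require Import complex.

Set Implicit Arguments.
Unset Strict Implicit.
Unset Printing Implicit Defensive.

Import Order.TTheory GRing.Theory Num.Theory.
Import numFieldNormedType.Exports.

Local Open Scope classical_set_scope.
Local Open Scope ring_scope.
Local Open Scope complex_scope.

(* The norm topology on R[i] is the one of the complex modulus, and
   [differentiable] / [derivable] on normed R[i]-modules then mean
   complex-differentiable. *)
HB.instance Definition _ (R : realType) := NormedModule.copy R[i] R[i]^o.

Section BinetLegendre.
Variables (R : realType) (n : nat).
Local Notation C := R[i].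
Local Notation V := 'rV[C]_n.

Definition borel_space := g_sigma_algebraType (@open V).

(* On C^n, which is second countable and locally compact, the regularity of
   Haar measures follows from their finiteness on compact sets. *)
Record haar_measure := HaarMeasure {
  haar :> {measure set borel_space -> \bar R} ;
  haar_translation : forall (v : V) (A : set V),
    measurable (A : set borel_space) -> haar [set v + x | x in A] = haar A ;
  haar_compact : forall K : set V, compact K -> (haar K < +oo)%E ;
  haar_neq0 : haar setT <> 0%E }.

Definition cintegral (mu : haar_measure) (D : set V) (f : V -> C) : C :=
  (\int[mu]_(x in (D : set borel_space)) complex.Re (f x)) +i*
  (\int[mu]_(x in (D : set borel_space)) complex.Im (f x)).

Definition unit_ball (F : V -> R) : set V := [set v | F v < 1].

Definition dual := 'Hom(V, C^o).

Definition dual_form (mu : haar_measure) (F : V -> R) (theta phi : dual) : C :=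
  (n.+1%:R / fine (mu (unit_ball F)))%:C *
  cintegral mu (unit_ball F) (fun x => theta x * (phi x)^*).

(* The unique mu(v) in the dual such that g*(phi, mu(v)) = phi(v) for all phi;
   it exists when F is a norm. *)
Definition riesz (mu : haar_measure) (F : V -> R) (v : V) : dual :=
  xget 0 [set t : dual | forall phi : dual, dual_form mu F phi t = phi v].

Definition binet_legendre (mu : haar_measure) (F : V -> R) (v w : V) : C :=
  dual_form mu F (riesz mu F w) (riesz mu F v).

(* An element of {i01 R[i]} is a real number between 0 and 1, so this is the
   convex hull in the underlying real vector space. *)
Definition convex_hull (A : set V) : set V :=
  smallest [set B : set V | convex_set B] A.

Definition hermitian_inner (h : V -> V -> C) : Prop :=
  [/\ forall a u v w, h (a *: u + v) w = a * h u w + h v w,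
      forall v w, h w v = (h v w)^*
    & forall v, v != 0 -> 0 < h v v].

End BinetLegendre.

Section Manifolds.
Variable R : realType.
Local Notation C := R[i].

Record chart (n : nat) (T : topologicalType) := Chart {
  chart_dom : set T ;
  chart_map :> T -> 'rV[C]_n ;
  chart_inv : 'rV[C]_n -> T ;
  chart_dom_open : open chart_dom ;
  chart_im_open : open (chart_map @` chart_dom) ;
  chart_mapK : forall x, chart_dom x -> chart_inv (chart_map x) = x ;
  chart_continuous : forall x, chart_dom x -> {for x, continuous chart_map} ;
  chart_inv_continuous :
    forall x, chart_dom x -> {for chart_map x, continuous chart_inv} }.

(* The holomorphic atlas is the family of the charts [chart_at p]; the choice
   of one of them around each point also identifies each holomorphic tangent
   space with C^n. *)
Record complex_manifold (n : nat) := ComplexManifold {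
  carrier :> topologicalType ;
  manifold_hausdorff : hausdorff_space carrier ;
  manifold_second_countable : @second_countable carrier ;
  chart_at : carrier -> chart n carrier ;
  chart_at_dom : forall p, chart_dom (chart_at p) p ;
  chart_transition : forall p q x,
    chart_dom (chart_at p) x -> chart_dom (chart_at q) x ->
    differentiable (chart_at q \o chart_inv (chart_at p)) (chart_at p x) }.

(* A tangent vector at p is represented by its coordinates in [chart_at p]. *)
Definition tangent n (M : complex_manifold n) (p : M) : Type := 'rV[C]_n.

Section Maps.
Variables (m n : nat) (M : complex_manifold m) (N : complex_manifold n).

Definition local_expr (f : M -> N) (p : M) : 'rV[C]_m -> 'rV[C]_n :=
  chart_at (f p) \o f \o chart_inv (chart_at p).

Definition holomorphic_at (f : M -> N) (p : M) : Prop :=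
  {for p, continuous f} /\ differentiable (local_expr f p) (chart_at p p).

Definition tangent_map (f : M -> N) (p : M) (v : tangent p) : tangent (f p) :=
  'd (local_expr f p) (chart_at p p) v.

End Maps.

Section Covering.
Variables (m n : nat) (M : complex_manifold m) (N : complex_manifold n).

Definition biholomorphic_on (f : M -> N) (U : set M) (W : set N) : Prop :=
  (forall p, U p -> W (f p) /\ holomorphic_at f p) /\
  exists g : N -> M,
    [/\ forall q, W q -> U (g q) /\ holomorphic_at g q,
        forall p, U p -> g (f p) = p
      & forall q, W q -> f (g q) = q].

Definition evenly_covered (f : M -> N) (W : set N) : Prop :=
  exists S : set (set M),
    [/\ \bigcup_(U in S) U = f @^-1` W,
        trivIset S id
      & forall U, S U -> open U /\ biholomorphic_on f U W].

Definition holomorphic_covering (f : M -> N) : Prop :=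
  (forall p, holomorphic_at f p) /\
  forall q, exists W : set N, open_nbhs q W /\ evenly_covered f W.

End Covering.

Section Kobayashi.
Variables (n : nat) (M : complex_manifold n).

(* The values of f outside the unit disc are irrelevant. *)
Definition holomorphic_disc (f : C -> M) : Prop :=
  forall z : C, `|z| < 1 ->
    {for z, continuous f} /\ derivable (chart_at (f z) \o f) z 1.

Definition disc_velocity0 (p : M) (f : C -> M) : tangent p :=
  derive1 (chart_at p \o f) 0.

Definition kobayashi (p : M) (v : tangent p) : R :=
  inf [set l^-1 | l in [set l : R | 0 < l /\
    exists f : C -> M, [/\ holomorphic_disc f, f 0 = p
      & disc_velocity0 p f = (l%:C *: (v : 'rV[C]_n) : tangent p)]]].

(* The tangent vector at q whose coordinates in the chart c are a. *)
Definition chart_vector (c : chart n M) (q : M) (a : 'rV[C]_n) : tangent q :=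
  'd (chart_at q \o chart_inv c) (c q) a.

Definition continuous_hermitian_on (U : set M)
    (h : forall q : M, tangent q -> tangent q -> C) : Prop :=
  (forall q, U q -> hermitian_inner (h q)) /\
  forall (p q : M) (a b : 'rV[C]_n), U q -> chart_dom (chart_at p) q ->
    {for q, continuous (fun x => h x (chart_vector (chart_at p) x a)
                                     (chart_vector (chart_at p) x b) : C)}.

Definition kobayashi_hyperbolic : Prop :=
  forall p : M, exists U : set M, open_nbhs p U /\
    exists h : forall q : M, tangent q -> tangent q -> C,
      continuous_hermitian_on U h /\
      exists2 c : R, 0 < c & forall (q : M) (v : tangent q), U q ->
        c * Num.sqrt (complex.Re (h q v v)) <= kobayashi v.

Definition kobayashi_busemann (p : M) (v : tangent p) : R :=
  inf [set t : R | 0 < t /\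
    convex_hull [set w : tangent p | kobayashi w < 1]
      ((t^-1)%:C *: (v : 'rV[C]_n))].

(* [mu p] is the Haar measure used on the tangent space at p; the value does
   not depend on it. *)
Definition kappa (mu : M -> haar_measure R n) (p : M) (v w : tangent p) : C :=
  binet_legendre (mu p) (@kobayashi_busemann p) v w.

End Kobayashi.
End Manifolds.

(* Main.v *)
Require Import Defs.
From HB Require Import structures.
From mathcomp Require Import all_boot all_order all_algebra.
From mathcomp Require Import all_classical all_reals all_analysis.
From mathcomp Require Import complex.
From mathcomp Require Import measurable_realfun ring lra.

(** The covering [f] identifies the Kobayashi metrics of [M] and [N], and each
    step from the Kobayashi metric to [kappa] commutes with complex linear
    isomorphisms of the tangent spaces.

    A holomorphic covering has local holomorphic inverses, so its derivative
    [L] at [p] is a linear isomorphism with continuous inverse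
    ([tangent_map_inverse]), and the dimensions agree ([covering_dim]).
    Holomorphic discs of [M] through [p] push forward to discs of [N] through
    [f p].  Conversely, the unit disc being star-shaped, every disc of [N]
    through [f p] lifts to a continuous map into [M] through [p]
    ([lift_star_shaped]), which is holomorphic since locally it is the disc
    followed by a local inverse of [f] ([disc_lift]).  Both infima that define
    the Kobayashi metrics thus run over the same set ([kobayashi_covering]).
    As [L] preserves convex combinations, it also carries the
    Kobayashi-Busemann metric of [M] to that of [N] ([busemann_covering]).

    There remains the naturality of the Binet-Legendre construction
    ([binet_legendre_linear]).  The image under [L] of a Haar measure is a Haar
    measure, and two Haar measures are proportional ([haar_unique], by Fubini),
    so the change of variables along [L] multiplies the integrals over the unit
    ball and the volume of the unit ball by one constant, which cancels.
    This needs the unit ball to be a Borel set; it is open because small vectors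
    are velocities of discs contained in a chart ([open_busemann_ball]).

    The element of the dual that represents a vector is selected by a choice
    operator.  Hermitian symmetry of the form on the dual makes
    [binet_legendre] independent of that choice ([binet_legendre_eq]), which is
    how the two sides are compared. *)

Set Implicit Arguments.
Unset Strict Implicit.
Unset Printing Implicit Defensive.

Import Order.TTheory GRing.Theory Num.Theory.
Import numFieldNormedType.Exports.

Local Open Scope classical_set_scope.
Local Open Scope ring_scope.
Local Open Scope complex_scope.

(** * Neighbourhoods and segments *)

Lemma near_eq_continuous (T U : topologicalType) (f g : T -> U) (x : T) :
  (\forall y \near x, f y = g y) ->
  {for x, continuous g} -> {for x, continuous f}.
Proof.
move=> fg gx; rewrite /prop_for /continuous_at (nbhs_singleton fg).
apply: cvg_trans gx; apply: near_eq_cvg.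
by apply: filterS fg => y ->.
Qed.

Lemma nbhs_distP (K : numFieldType) (V : normedModType K) (x : V) (A : set V) :
  nbhs x A <-> exists2 e : K, 0 < e & forall y, `|y - x| < e -> A y.
Proof.
rewrite nbhs_ballP; split=> -[e /= e0 eA]; exists e => // y.
  by move=> yx; apply: eA; rewrite -ball_normE /= distrC.
by rewrite -ball_normE /= distrC; exact: eA.
Qed.

(** The supremum of the parameters at which [P] holds is itself one, and by
    the local hypothesis it can only be [1]. *)
Lemma segment_induction (R : realType) (P : R -> Prop) :
  P 0 ->
  (forall r, 0 <= r <= 1 -> exists2 e, 0 < e &
    forall s t, 0 <= s <= 1 -> 0 <= t <= 1 ->
      `|s - r| < e -> `|t - r| < e -> P s -> P t) ->
  P 1.
Proof.
move=> P0 Ploc; pose A := [set t : R | 0 <= t <= 1 /\ P t].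
have A0 : A 0 by split=> //; rewrite lexx ler01.
have A1 : ubound A 1 by move=> t [/andP[]].
have supA : has_sup A by split; [exists 0|exists 1].
have r01 : 0 <= sup A <= 1.
  by rewrite (ub_le_sup supA.2 A0) (ge_sup supA.1 A1).
have [e e0 He] := Ploc _ r01.
have [s [s01 Ps] es] := sup_adherent e0 supA.
have les : s <= sup A by apply: (ub_le_sup supA.2).
have At t : 0 <= t <= 1 -> `|t - sup A| < e -> P t.
  by move=> t01 te; apply: (He s) => //; rewrite ltr_norml; apply/andP; split; lra.
have [r1|r1] := leP 1 (sup A + e / 2).
  by apply: At; [|rewrite ltr_norml; apply/andP; split]; lra.
have : A (sup A + e / 2).
  have h : 0 <= sup A + e / 2 <= 1 by lra.
  by split=> //; apply: At => //; rewrite ltr_norml; apply/andP; split; lra.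
by move/(ub_le_sup supA.2); lra.
Qed.

Lemma normc_real (R : realType) (t : R) : `|t%:C| = `|t|%:C.
Proof. by rewrite normc_def /= expr0n addr0 sqrtr_sqr. Qed.

Section Segments.
Variables (R : realType) (E : normedModType R[i]).

Lemma line_near (A : set E) (x v : E) (r : R) :
  nbhs (x + r%:C *: v) A ->
  exists2 e : R, 0 < e & forall s, `|s - r| < e -> A (x + s%:C *: v).
Proof.
move=> /nbhs_ballP[d /= d0 Ad].
have k0 : 0 < d / (`|v| + 1) by rewrite divr_gt0 // ltr_wpDl.
have kr := RRe_real (gtr0_real k0).
exists (complex.Re (d / (`|v| + 1))); first by rewrite -ltcR kr.
move=> s; rewrite -ltcR kr => sr; apply: Ad.
rewrite -ball_normE /= opprD addrACA subrr add0r -scalerBl -rmorphB normrZ.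
rewrite normc_real distrC.
have v0 : 0 < `|v| + 1 by rewrite ltr_wpDl.
rewrite ltr_pdivlMr // in sr; apply: le_lt_trans sr.
by rewrite ler_wpM2l ?lecR // lerDl.
Qed.

Lemma norm_segment_lt (u w : E) (e : R[i]) (r : R) : 0 <= r <= 1 ->
  `|u| < e -> `|w| < e -> `|u + r%:C *: (w - u)| < e.
Proof.
move=> r01 ue we; have [r0 r1] : 0 <= r /\ 0 <= 1 - r by lra.
have -> : u + r%:C *: (w - u) = (1 - r)%:C *: u + r%:C *: w.
  by rewrite rmorphB scalerBl scale1r scalerBr addrA addrAC.
rewrite (le_lt_trans (ler_normD _ _)) // !normrZ !normc_real.
rewrite (ger0_norm r0) (ger0_norm r1).
have [rz|rz] := eqVneq r 0; first by rewrite rz subr0 mul0r addr0 mul1r.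
have r0' : 0 < r%:C by rewrite ltcR lt_def rz.
have -> : e = (1 - r)%:C * e + r%:C * e by rewrite rmorphB /=; ring.
by rewrite ler_ltD ?ler_wpM2l ?ltr_pM2l ?(ltW ue) // lecR.
Qed.

Lemma ball_segment (c x y : E) (e : R[i]) (r : R) : 0 <= r <= 1 ->
  ball c e x -> ball c e y -> ball c e (x + r%:C *: (y - x)).
Proof.
rewrite -ball_normE /= => r01; rewrite !(distrC c) => xe ye.
by have := norm_segment_lt r01 xe ye; rewrite opprB addrA subrK addrAC.
Qed.

End Segments.

(** * Lifting maps through coverings *)

Section CoveringMaps.
Variables (T B : topologicalType) (f : T -> B).

Definition sheet (W : set B) (U : set T) : Prop :=
  open U /\ exists h : B -> T,
    [/\ forall y, W y -> [/\ U (h y), f (h y) = y & {for y, continuous h}]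
      & forall x, U x -> W (f x) /\ h (f x) = x].

Definition covering_map : Prop :=
  forall b, exists2 W : set B, open_nbhs b W &
    exists S : set (set T),
      [/\ \bigcup_(U in S) U = f @^-1` W, trivIset S id
        & forall U, S U -> sheet W U].

Variables (R : realType) (E : normedModType R[i]).

Hypothesis f_cov : covering_map.

(** Near each parameter both lifts stay in one sheet each; if they meet there,
    disjointness of the sheets makes these sheets the same one, on which [f] is
    injective. *)
Lemma lift_unique (a b : E -> T) (x v : E) :
  (forall t : R, 0 <= t <= 1 ->
    [/\ {for x + t%:C *: v, continuous a}, {for x + t%:C *: v, continuous b}
      & f (a (x + t%:C *: v)) = f (b (x + t%:C *: v))]) ->
  a x = b x -> a (x + v) = b (x + v).
Proof.
move=> H ab0; rewrite -[v]scale1r.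
apply: (@segment_induction _ (fun t => a (x + t%:C *: v) = b (x + t%:C *: v))).
  by rewrite scale0r addr0.
move=> r r01; have [ca cb fab] := H _ r01.
have [W [oW Wc] [S [SW Striv Ssh]]] := f_cov (f (a (x + r%:C *: v))).
have [Ua SUa Uaa] : (\bigcup_(U in S) U) (a (x + r%:C *: v)) by rewrite SW.
have [Ub SUb Ubb] : (\bigcup_(U in S) U) (b (x + r%:C *: v)).
  by rewrite SW /= -fab.
have [oUa [h [_ ha]]] := Ssh _ SUa.
have [oUb _] := Ssh _ SUb.
have [e1 e10 He1] := line_near (ca _ (open_nbhs_nbhs (conj oUa Uaa))).
have [e2 e20 He2] := line_near (cb _ (open_nbhs_nbhs (conj oUb Ubb))).
exists (Num.min e1 e2); first by rewrite lt_min e10.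
move=> s t s01 t01; rewrite !lt_min => /andP[s1 s2] /andP[t1 t2] abs.
(* The two lifts meet at s, so they lie in the same sheet. *)
have UU : Ub = Ua.
  by apply: Striv => //; exists (b (x + s%:C *: v)); split;
    [exact: He2|rewrite -abs; exact: He1].
have [_ <-] := ha _ (He1 _ t1); have [_ _ ->] := H _ t01.
have [|_ //] := ha (b (x + t%:C *: v)).
by rewrite -UU; exact: He2.
Qed.

(** The open [e]-neighbourhood of the segment from [0] to [t z].  Lifts are built
    on such sets because they are convex: two lifts that agree at one point of
    an intersection of tubes and balls agree on all of it. *)
Definition tube (z : E) (t : R) (e : R[i]) : set E :=
  [set y | exists2 s : R, 0 <= s <= t & `|y - s%:C *: z| < e].

Lemma open_tube z t e : open (tube z t e).
Proof.
rewrite openE => y [s st ys].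
have e0 : 0 < e - `|y - s%:C *: z| by rewrite subr_gt0.
apply/nbhs_ballP; exists (e - `|y - s%:C *: z|) => //= y'.
rewrite -ball_normE /= => yy'; exists s => //.
have -> : y' - s%:C *: z = (y' - y) + (y - s%:C *: z) by rewrite addrA subrK.
by rewrite (le_lt_trans (ler_normD _ _)) // -ltrBrDr distrC.
Qed.

Lemma tube_segment z t e x y (r : R) : 0 <= r <= 1 ->
  tube z t e x -> tube z t e y -> tube z t e (x + r%:C *: (y - x)).
Proof.
move=> r01 [s1 s1t h1] [s2 s2t h2]; exists (s1 + r * (s2 - s1)).
  by apply/andP; split; nra.
have := norm_segment_lt r01 h1 h2.
rewrite (opprD x) (addrACA y) -(opprD (s2%:C *: z)) -scalerBl -rmorphB.
rewrite scalerBr addrACA -opprD.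
by rewrite scalerA -rmorphM -scalerDl -rmorphD.
Qed.

Variables (D : set E) (g : E -> B) (p : T).
Hypotheses (D_open : open D) (g_cont : forall z, D z -> {for z, continuous g}).
Hypothesis D_star : forall z (t : R), 0 <= t <= 1 -> D z -> D (t%:C *: z).
Hypothesis gp : g 0 = f p.

Definition tube_lift (z : E) (t : R) (e : R[i]) (d : E -> T) : Prop :=
  [/\ 0 < e, tube z t e `<=` D, d 0 = p &
    forall y, tube z t e y -> f (d y) = g y /\ {for y, continuous d}].

Lemma tube_lift_unique z t e d z' t' e' d' y : 0 <= t -> 0 <= t' ->
  tube_lift z t e d -> tube_lift z' t' e' d' ->
  tube z t e y -> tube z' t' e' y -> d y = d' y.
Proof.
move=> t0 t0' [e0 _ d0 Hd] [e0' _ d0' Hd'] ty ty'.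
rewrite -[y]add0r; apply: lift_unique; last by rewrite d0 d0'.
move=> r r01; rewrite add0r.
have c0 z1 t1 e1 : 0 <= t1 -> 0 < e1 -> tube z1 t1 e1 y -> tube z1 t1 e1 (r%:C *: y).
  move=> t10 e10 ty1; have -> : r%:C *: y = 0 + r%:C *: (y - 0) by rewrite subr0 add0r.
  by apply: tube_segment => //; exists 0; rewrite ?lexx // scale0r subrr normr0.
have [fd cd] := Hd _ (c0 _ _ _ t0 e0 ty).
have [fd' cd'] := Hd' _ (c0 _ _ _ t0' e0' ty').
by split; rewrite // fd fd'.
Qed.

(** Extension step of the lifting.  Around [c = r z] there is a ball of radius
    [k] over which the target is evenly covered.  If the tube up to [s z] has a
    lift and [s z] is close to [c], that lift selects a sheet above the ball, and
    the section with values in this sheet extends the lift over the ball; the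
    tube up to [t z] is contained in the union. *)
Lemma tube_lift_step z : D z -> forall r : R, 0 <= r <= 1 ->
  exists2 h : R, 0 < h & forall s t : R, 0 <= s <= 1 -> 0 <= t <= 1 ->
    `|s - r| < h -> `|t - r| < h ->
    (exists e d, tube_lift z s e d) -> exists e d, tube_lift z t e d.
Proof.
move=> Dz r r01; have Dc := D_star r01 Dz; set c := r%:C *: z in Dc.
have [W [oW Wc] [S [SW Striv Ssh]]] := f_cov (g c).
have : nbhs c (D `&` g @^-1` W).
  apply: filterI; first exact: open_nbhs_nbhs.
  exact: (g_cont Dc (open_nbhs_nbhs (conj oW Wc))).
move=> /nbhs_ballP[k /= k0 kD].
have k20 : 0 < k / 2 by rewrite divr_gt0.
have [h h0 Hh] : exists2 h : R, 0 < h & forall s, `|s - r| < h ->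
    ball c (k / 2) (s%:C *: z).
  have [|h h0 Hh] := @line_near R E (ball c (k / 2)) 0 z r.
    by rewrite add0r; apply: nbhsx_ballx.
  by exists h => // s /Hh; rewrite add0r.
exists h => // s t s01 t01 sr tr [e [d dl]].
have [e0 tD d0 Hd] := dl.
have bs := Hh _ sr.
have bk y : ball c (k / 2) y -> ball c k y.
  by apply: le_ball; rewrite ler_pdivrMr // ler_pMr // ler1n.
have ts : tube z s e (s%:C *: z).
  by exists s; [case/andP: s01 => -> _; rewrite lexx|rewrite subrr normr0].
have [fds cds] := Hd _ ts.
have [U SU Uds] : (\bigcup_(U in S) U) (d (s%:C *: z)).
  by rewrite SW /= fds; have [] := kD _ (bk _ bs).
have [oU [i [iP iK]]] := Ssh _ SU.
(* The two definitions agree on the overlap, by uniqueness of lifts along the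
   segment from s z, which stays in both convex sets. *)
have di y : tube z s e y -> ball c k y -> d y = i (g y).
  move=> ty by_; rewrite -(subrK (s%:C *: z) y) addrC.
  apply: (@lift_unique d (i \o g)) => [q q01|]; last first.
    by rewrite /= -fds; have [_ ->] := iK _ Uds.
  have tq := tube_segment q01 ts ty.
  have [fdq cdq] := Hd _ tq.
  have bq := ball_segment q01 (bk _ bs) by_.
  have [Dq Wq] := kD _ bq.
  have [Uiq fiq ciq] := iP _ Wq.
  split=> //; last by rewrite fdq /= fiq.
  by apply: continuous_comp; [exact: g_cont|].
pose d' y := if pselect (tube z s e y) then d y else i (g y).
have d'E y : ball c k y -> d' y = i (g y).
  by move=> by_; rewrite /d'; case: pselect => // ty; exact: di.
have d'E' y : tube z s e y -> d' y = d y by rewrite /d'; case: pselect.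
have [t0 s0] : 0 <= t /\ 0 <= s by lra.
have kc : e >=< k / 2 by rewrite real_comparable ?gtr0_real.
have tubeP y : tube z t (Num.min e (k / 2)) y -> tube z s e y \/ ball c k y.
  move=> [q /andP[q0 qt]]; rewrite (comparable_lt_min _ kc) => /andP[yqe yqk].
  have [qs|sq] := leP q s; first by left; exists q; rewrite ?q0.
  right; rewrite (splitr k); apply: ball_triangle (Hh q _) _.
    by move: sr tr; rewrite !ltr_norml => /andP[? ?] /andP[? ?]; apply/andP; split; lra.
  by rewrite -ball_normE /= distrC.
exists (Num.min e (k / 2)), d'; split.
- by rewrite (comparable_lt_min _ kc) e0.
- by move=> y /tubeP[/tD //|/kD[]].
- rewrite d'E' //; exists 0; first by rewrite lexx.
  by rewrite scale0r subrr normr0.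
- move=> y /tubeP[ty|by_].
    have [fd cd] := Hd _ ty; rewrite d'E' //; split=> //.
    apply: (near_eq_continuous _ cd).
    move: (open_nbhs_nbhs (conj (@open_tube z s e) ty)).
    by apply: filterS => y'; exact: d'E'.
  have [Dy Wy] := kD _ by_; have [_ fi ci] := iP _ Wy.
  rewrite d'E //; split=> //; apply: (@near_eq_continuous _ _ _ (i \o g)).
    move: (open_nbhs_nbhs (conj (@ball_open _ _ c k) by_)).
    by apply: filterS => y'; exact: d'E.
  by apply: continuous_comp; [exact: g_cont|].
Qed.

(** Each point [z] has a lift on a tube around the segment from [0] to [z], and
    the global lift takes at [z] the value of that one.  It is continuous because
    for [y] near [z] the segment from [0] to [y] lies in the tube of [z], where
    both lifts agree. *)
Lemma lift_star_shaped : exists d : E -> T, d 0 = p /\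
  forall z, D z -> f (d z) = g z /\ {for z, continuous d}.
Proof.
have [-> |/set0P[z0 Dz0]] := eqVneq D set0; first by exists (fun=> p).
have H z : exists ed : R[i] * (E -> T), D z -> tube_lift z 1 ed.1 ed.2.
  have [Dz|nDz] := pselect (D z); last by exists (1, fun=> p).
  suff [e [d ?]] : exists e d, tube_lift z 1 e d by exists (e, d).
  apply: (@segment_induction _ (fun t => exists e d, tube_lift z t e d));
    last exact: tube_lift_step.
  have D0 : D 0 by rewrite -(scale0r z); apply: (D_star _ Dz); rewrite lexx ler01.
  have [W [oW Wc] [S [SW Striv Ssh]]] := f_cov (f p).
  have [U SU Up] : (\bigcup_(U in S) U) p by rewrite SW.
  have [oU [i [iP iK]]] := Ssh _ SU.
  have : nbhs (0 : E) (D `&` g @^-1` W).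
    apply: filterI; first exact: open_nbhs_nbhs.
    by apply: (g_cont D0 (open_nbhs_nbhs (conj oW _))); rewrite gp.
  move=> /nbhs_ballP[k /= k0 kD]; exists k, (i \o g).
  have tk y : tube z 0 k y -> ball 0 k y.
    move=> [s s0]; have -> : s = 0 by apply/eqP; rewrite eq_le andbC.
    by rewrite scale0r subr0 -ball_normE /= sub0r normrN.
  split => //; first by move=> y /tk /kD[].
    by rewrite /= gp; have [_] := iK _ Up.
  move=> y /tk /kD[Dy Wy]; have [Uy fiy ciy] := iP _ Wy; split=> //.
  by apply: continuous_comp; [exact: g_cont|].
have [ed edP] := choice H.
have self z t e : 0 <= t -> 0 < e -> tube z t e (t%:C *: z).
  by move=> t0 e0; exists t; rewrite ?t0 ?lexx // subrr normr0.
have self1 z e : 0 < e -> tube z 1 e z.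
  by move=> e0; rewrite -{2}[z]scale1r; apply: self.
exists (fun z => (ed z).2 z); split.
  have D0 : D 0 by rewrite -(scale0r z0); apply: (D_star _ Dz0); rewrite lexx ler01.
  by have [] := edP _ D0.
move=> z Dz; have zl := edP _ Dz; have [e0 tD _ Hd] := zl.
have [fd cd] := Hd _ (self1 _ _ e0); split=> //.
apply: (near_eq_continuous _ cd).
apply/nbhs_ballP; exists (ed z).1 => //= y; rewrite -ball_normE /= distrC => yz.
have ty : tube z 1 (ed z).1 y by exists 1; rewrite ?ler01 ?lexx // scale1r.
have yl := edP _ (tD _ ty); have [ey0 _ _ _] := yl.
exact: (tube_lift_unique ler01 ler01 yl zl (self1 _ _ ey0) ty).
Qed.

End CoveringMaps.

(** * Differentials of maps between manifolds *)

Section Germs.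
Variables (K : numFieldType) (V W : normedModType K).

Lemma near_eq_differentiable (f g : V -> W) (x : V) :
  (\forall y \near x, f y = g y) -> differentiable g x ->
  differentiable f x /\ 'd f x = 'd g x :> (V -> W).
Proof.
move=> fg dg.
have cg : continuous ('d g x) by exact: diff_continuous.
have fE : f \o shift x = cst (f x) + 'd g x +o_ 0 id.
  have /eqaddoP gE := diff_locally dg.
  apply/eqaddoP => e e0; move: (gE e e0).
  rewrite (nbhs_singleton fg).
  have fg0 : \forall h \near 0, f (h + x) = g (h + x).
    by move: fg; rewrite (near_shift 0 x) subr0.
  by apply: filterS2 fg0 => h; rewrite /= !fctE /= => ->.
have dE := diff_unique cg fE.
split; last exact: dE.
by apply/diff_locallyP; rewrite dE; split.
Qed.

End Germs.

Section Manifolds.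
Variable R : realType.
Local Notation C := R[i].

Lemma near_chart_dom n (M : complex_manifold R n) (p : M) :
  nbhs p (chart_dom (chart_at p)).
Proof.
apply: open_nbhs_nbhs; split; first exact: chart_dom_open.
exact: chart_at_dom.
Qed.

Lemma chart_atK n (M : complex_manifold R n) (p : M) :
  chart_inv (chart_at p) (chart_at p p) = p.
Proof. by rewrite chart_mapK //; exact: chart_at_dom. Qed.

Lemma near_chart_inv n (M : complex_manifold R n) (p : M) (A : set M) :
  nbhs p A ->
  \forall x \near chart_at p p, A (chart_inv (chart_at p) x).
Proof.
move=> Ap; apply: (chart_inv_continuous (chart_at_dom p)).
by rewrite chart_atK.
Qed.

Lemma near_chart_invK n (M : complex_manifold R n) (p : M) :
  \forall x \near chart_at p p, chart_at p (chart_inv (chart_at p) x) = x.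
Proof.
have : open_nbhs (chart_at p p) (chart_at p @` chart_dom (chart_at p)).
  split; first exact: chart_im_open.
  by exists p => //; exact: chart_at_dom.
move=> /open_nbhs_nbhs; apply: filterS => _ [x xp <-].
by rewrite chart_mapK.
Qed.

Section Composition.
Variables (m n k : nat).
Variables (M : complex_manifold R m) (N : complex_manifold R n).
Variable P : complex_manifold R k.

Lemma local_expr_comp (f : M -> N) (g : N -> P) (p : M) :
  {for p, continuous f} ->
  \forall x \near chart_at p p,
    local_expr (g \o f) p x = local_expr g (f p) (local_expr f p x).
Proof.
move=> fp; have := near_chart_inv (fp _ (near_chart_dom (f p))).
by apply: filterS => x xf; rewrite /local_expr /= chart_mapK.
Qed.

Lemma local_exprE (f : M -> N) (p : M) :
  local_expr f p (chart_at p p) = chart_at (f p) (f p).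
Proof. by rewrite /local_expr /= chart_atK. Qed.

Lemma holomorphic_comp (f : M -> N) (g : N -> P) (p : M) :
  holomorphic_at f p -> holomorphic_at g (f p) ->
  holomorphic_at (g \o f) p /\
  forall v : tangent p,
    tangent_map (g \o f) v = tangent_map g (tangent_map f v).
Proof.
move=> [fc fd] [gc gd]; rewrite -local_exprE in gd.
have [d dE] := near_eq_differentiable (local_expr_comp g fc)
  (differentiable_comp fd gd).
split; first by split; [apply: continuous_comp|exact: d].
move=> v; rewrite /tangent_map dE diff_comp; [|exact: fd|exact: gd].
by rewrite -[in RHS]local_exprE.
Qed.

Lemma disc_comp (f : M -> N) (d : C -> M) (z : C) :
  {for z, continuous d} -> derivable (chart_at (d z) \o d) z 1 ->
  holomorphic_at f (d z) ->
  [/\ {for z, continuous (f \o d)},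
      derivable (chart_at (f (d z)) \o (f \o d)) z 1
    & derive1 (chart_at (f (d z)) \o (f \o d)) z =
      tangent_map f (derive1 (chart_at (d z) \o d) z : tangent (d z))].
Proof.
move=> dc /derivable1_diffP dd [fc fd].
have E : \forall y \near z, (chart_at (f (d z)) \o (f \o d)) y =
    (local_expr f (d z) \o (chart_at (d z) \o d)) y.
  have domz : \forall y \near z, chart_dom (chart_at (d z)) (d y).
    exact: (dc _ (near_chart_dom (d z))).
  move: domz; apply: filterS => y yd.
  by rewrite /local_expr /= chart_mapK.
have [h hE] := near_eq_differentiable E (differentiable_comp dd fd).
split; first by apply: continuous_comp.
  exact/derivable1_diffP.
rewrite derive1E'; last exact: h.
rewrite derive1E'; last exact: dd.
by rewrite hE diff_comp; [|exact: dd|exact: fd].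
Qed.

End Composition.

Lemma near_unit_disc (z : C) : `|z| < 1 -> \forall y \near z, `|y| < 1.
Proof.
move=> z1; apply/nbhs_ballP.
exists (1 - `|z|) => /=; first by rewrite subr_gt0.
move=> y; rewrite -ball_normE /= ltrBrDl distrC => yz.
have -> : y = z + (y - z) by rewrite addrC subrK.
exact: le_lt_trans (ler_normD _ _) yz.
Qed.

(** The statement allows [g] to differ from the identity far from [p], as does a
    local section of a covering followed by the covering. *)
Lemma germ_id_tangent_map n (P : complex_manifold R n) (g : P -> P) (p : P) :
  (\forall x \near p, g x = x) ->
  forall v : tangent p, tangent_map g v = v :> 'rV_n.
Proof.
move=> gid v.
have E : \forall x \near chart_at p p, local_expr g p x = x.
  have := near_chart_inv gid; move: (near_chart_invK p).
  apply: filterS2 => x xK gx.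
  by rewrite /local_expr /= gx (nbhs_singleton gid).
have [|_ dE] := near_eq_differentiable E; first exact: ex_diff.
by rewrite /tangent_map dE diff_val.
Qed.

Lemma inj_linear_leq (K : fieldType) (a b : nat)
    (L : {linear 'rV[K]_a -> 'rV[K]_b}) :
  injective L -> (a <= b)%N.
Proof.
move=> Linj; suff : row_free (lin1_mx L).
  by move=> /eqP <-; exact: rank_leq_col.
apply: inj_row_free => v; rewrite mul_rV_lin1 => Lv0.
by apply: Linj; rewrite Lv0 linear0.
Qed.

(** * Holomorphic discs and the Kobayashi metric *)

Section Pushforward.
Variables (m n : nat) (M : complex_manifold R m) (N : complex_manifold R n).
Variables (f : M -> N) (f_hol : forall p, holomorphic_at f p).

Lemma disc_pushforward (d : C -> M) :
  holomorphic_disc d -> holomorphic_disc (f \o d).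
Proof.
move=> dh z z1; have [dc dd] := dh _ z1.
by have [] := disc_comp dc dd (f_hol _).
Qed.

Lemma disc_velocity_pushforward (p : M) (d : C -> M) :
  holomorphic_disc d -> d 0 = p ->
  disc_velocity0 (f p) (f \o d) = tangent_map f (disc_velocity0 p d).
Proof.
move=> dh dp; rewrite -dp.
have [|dc dd] := dh 0; first by rewrite normr0 ltr01.
by have [_ _ E] := disc_comp dc dd (f_hol _).
Qed.

End Pushforward.

Section LocalInverse.
Variables (m n : nat) (M : complex_manifold R m) (N : complex_manifold R n).
Variable f : M -> N.
Hypothesis f_cov : holomorphic_covering f.

Lemma covering_local_inverse (p : M) : exists g : N -> M,
  [/\ g (f p) = p, holomorphic_at g (f p),
      \forall q \near f p, f (g q) = q & \forall x \near p, g (f x) = x].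
Proof.
have [_ /(_ (f p))[W [[oW Wp] [S [SW _ Ssh]]]]] := f_cov.
have [U SU Up] : (\bigcup_(U in S) U) p by rewrite SW.
have [oU [fU [g [gW gK fK]]]] := Ssh _ SU.
exists g; split; [exact: gK|by have [] := gW _ Wp| |].
- exact: filterS fK (open_nbhs_nbhs (conj oW Wp)).
- exact: filterS gK (open_nbhs_nbhs (conj oU Up)).
Qed.

(** The chain rule applied to both composites of [f] with a local inverse. *)
Lemma tangent_map_inverse (p : M) : exists L : {linear 'rV[C]_n -> 'rV[C]_m},
  [/\ continuous L, forall v : tangent p, L (tangent_map f v) = v
    & forall w : tangent (f p), tangent_map f (L w : tangent p) = w].
Proof.
have [g [gp gh fg gf]] := covering_local_inverse p.
have fh := f_cov.1 p.
exists ('d (local_expr g (f p)) (chart_at (f p) (f p))); split.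
- by apply: diff_continuous; have [] := gh.
- move=> v; have [_ E] := holomorphic_comp fh gh.
  by rewrite -[LHS]E; exact: germ_id_tangent_map.
- move=> w; have := germ_id_tangent_map fg w.
  by have [|_ ->] := holomorphic_comp gh (g := f); rewrite gp.
Qed.

Lemma tangent_map_continuous (p : M) :
  continuous (@tangent_map _ _ _ _ _ f p : 'rV_m -> 'rV_n).
Proof. by apply: diff_continuous; have [] := f_cov.1 p. Qed.

Lemma covering_dim (p : M) : m = n.
Proof.
have [L [_ LK KL]] := tangent_map_inverse p.
apply/eqP; rewrite eqn_leq; apply/andP; split.
  apply: (@inj_linear_leq _ _ _ ('d (local_expr f p) (chart_at p p))).
  exact: can_inj LK.
by apply: (@inj_linear_leq _ _ _ L); exact: can_inj KL.
Qed.

Lemma holomorphic_covering_map : covering_map f.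
Proof.
move=> q; have [_ /(_ q)[W [oW [S [SW Striv Ssh]]]]] := f_cov.
exists W => //; exists S; split=> // U /Ssh[oU [fU [g [gW gK fK]]]].
split=> //; exists g; split=> [y Wy|x Ux].
  by have [Ug [gc _]] := gW _ Wy; split=> //; exact: fK.
by split; [have [] := fU _ Ux|exact: gK].
Qed.

(** The continuous lift [d] given by the covering is holomorphic because near
    each point it coincides with [g \o e], for a local inverse [g] of [f]. *)
Lemma disc_lift (p : M) (e : C -> N) : holomorphic_disc e -> e 0 = f p ->
  exists d : C -> M, [/\ holomorphic_disc d, d 0 = p &
    forall z : C, `|z| < 1 -> f (d z) = e z].
Proof.
move=> eh e0.
have oD : open [set z : C | `|z| < 1].
  by rewrite openE => z /near_unit_disc.
have [] := @lift_star_shaped _ _ f R C holomorphic_covering_map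
  [set z : C | `|z| < 1] e p oD.
- by move=> z /eh[].
- move=> z t /andP[t0 t1] /= z1; rewrite normrZ normc_real ger0_norm //.
  apply: le_lt_trans z1; rewrite ler_piMl //.
  by rewrite -[1]/(1%:C) lecR.
- by rewrite e0.
move=> d [d0 dE]; exists d; split=> //; last by move=> z /dE[].
move=> z z1; have [fd dc] := dE _ z1; split=> //.
have [g [gp gh fg gf]] := covering_local_inverse (d z).
have [ec ed] := eh _ z1.
have gh' : holomorphic_at g (e z) by rewrite -fd.
have [_ h _] := disc_comp ec ed gh'; rewrite -fd gp in h.
apply/derivable1_diffP; move/derivable1_diffP: h => h.
have E : \forall y \near z, (chart_at (d z) \o d) y = (chart_at (d z) \o (g \o e)) y.
  have D : \forall y \near z, g (f (d y)) = d y by exact: (dc _ gf).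
  have D' : \forall y \near z, f (d y) = e y.
    by move: (near_unit_disc z1); apply: filterS => y /dE[].
  by move: D D'; apply: filterS2 => y /= Dy D'y; rewrite -D'y Dy.
by have [] := near_eq_differentiable E h.
Qed.

Lemma kobayashi_covering (p : M) (v : tangent p) :
  kobayashi (tangent_map f v) = kobayashi v.
Proof.
rewrite /kobayashi; congr (inf [set l^-1 | l in _]).
have [L [_ LK KL]] := tangent_map_inverse p.
have fZ (l : C) : tangent_map f (l *: (v : 'rV[C]_m) : tangent p) =
    l *: (tangent_map f v : 'rV[C]_n) by rewrite /tangent_map linearZ.
apply/seteqP; split=> l /= [l0 [e [dh d0 dv]]]; split=> //.
  have [d' [dh' d0' dE]] := disc_lift dh d0.
  exists d'; split; [exact: dh'|exact: d0'|].
  have E := disc_velocity_pushforward f_cov.1 dh' d0'.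
  have dvE : disc_velocity0 (f p) (f \o d') = disc_velocity0 (f p) e.
    rewrite /disc_velocity0 [LHS]derive1E [RHS]derive1E; apply: near_eq_derive.
    have : `|0 : C| < 1 by rewrite normr0 ltr01.
    by move=> /near_unit_disc; apply: filterS => z z1; rewrite /= dE.
  have H := etrans (esym E) (etrans dvE dv).
  by rewrite -[LHS]LK H -fZ LK.
exists (f \o e); split; first exact: (disc_pushforward f_cov.1).
  by rewrite /= d0.
by rewrite (disc_velocity_pushforward f_cov.1) // dv fZ.
Qed.
End LocalInverse.
End Manifolds.

(** * The Kobayashi-Busemann unit ball *)

Section ConvexHull.
Variable R : realType.
Local Notation C := R[i].

Lemma sub_convex_hull n (A : set 'rV[C]_n) : A `<=` convex_hull A.
Proof. exact: sub_smallest. Qed.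

Lemma convex_hull_convex n (A : set 'rV[C]_n) (x y : 'rV[C]_n) (r : R) :
  0 <= r -> r <= 1 -> convex_hull A x -> convex_hull A y ->
  convex_hull A (r%:C *: x + (1 - r)%:C *: y).
Proof.
move=> r0 r1 hx hy B [Bc AB].
have r0' : 0 <= r%:C by rewrite lecR.
have r1' : r%:C <= 1 by rewrite -[1]/(1%:C) lecR.
have := Bc x y (Itv01 r0' r1') (mem_set (hx _ (conj Bc AB)))
  (mem_set (hy _ (conj Bc AB))).
by rewrite inE rmorphB.
Qed.

Lemma convex_hull_linear m n (L : {linear 'rV[C]_m -> 'rV[C]_n})
    (A : set 'rV[C]_m) (B : set 'rV[C]_n) :
  A `<=` L @^-1` B -> convex_hull A `<=` L @^-1` convex_hull B.
Proof.
move=> AB; apply: smallest_sub => [|v Av]; last first.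
  exact: (@sub_convex_hull _ B _ (AB _ Av)).
move=> x y k; rewrite !inE /= => hx hy D [Dc BD].
have := Dc _ _ k (mem_set (hx _ (conj Dc BD))) (mem_set (hy _ (conj Dc BD))).
by rewrite inE /conv /= linearD !linearZ.
Qed.

Definition gauge n (K : set 'rV[C]_n) (v : 'rV[C]_n) : R :=
  inf [set t : R | 0 < t /\ K ((t^-1)%:C *: v)].

(** Since [A] absorbs every vector, the infimum runs over a nonempty set, and so
    is not the default value [0] of [inf] on the empty set. *)
Lemma gauge_lt1P n (A : set 'rV[C]_n) (v : 'rV[C]_n) :
  nbhs (0 : 'rV[C]_n) A ->
  gauge (convex_hull A) v < 1 <->
  exists2 t : R, 0 < t < 1 & convex_hull A ((t^-1)%:C *: v).
Proof.
move=> /nbhs_distP[e e0 eA]; split=> [|[t /andP[t0 t1] ht]]; last first.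
  apply: le_lt_trans t1; apply: ge_inf => //.
  by exists 0 => s /= [/ltW].
have ne : [set t : R | 0 < t /\ convex_hull A ((t^-1)%:C *: v)] !=set0.
  have k0 : 0 < (`|v| + 1) / e by rewrite divr_gt0 // ltr_wpDl.
  have kr := RRe_real (gtr0_real k0).
  exists (complex.Re ((`|v| + 1) / e)); split; first by rewrite -ltcR kr.
  apply: (@sub_convex_hull n A); apply: eA; rewrite subr0 fmorphV /= kr.
  rewrite invf_div normrZ gtr0_norm ?divr_gt0 // ?ltr_wpDl //.
  rewrite mulrAC ltr_pdivrMr ?ltr_wpDl //.
  by rewrite ltr_pM2l // ltrDl.
move=> /(inf_lt ne)[t [t0 ht] t1].
by exists t; rewrite ?t0.
Qed.

(** If [v] lies in [t K] with [t < 1] and [s] is strictly between [t] and [1],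
    then adding to [v] a vector of [(s - t) K] gives an element of [s K], by
    convexity of [K]; here [K] contains a ball around [0]. *)
Lemma open_unit_ball_gauge n (A : set 'rV[C]_n) :
  nbhs (0 : 'rV[C]_n) A -> open (unit_ball (gauge (convex_hull A))).
Proof.
move=> A0; have := A0 => /nbhs_distP[e e0 eA].
rewrite openE => v /= /(gauge_lt1P v A0)[t /andP[t0 t1] ht].
pose s := (1 + t) / 2; have ts : t < s by rewrite /s; lra.
have s1 : s < 1 by rewrite /s; lra.
have s0 : 0 < s := lt_trans t0 ts.
have st0 : 0 < s - t by rewrite subr_gt0.
apply/nbhs_distP; exists ((s - t)%:C * e).
  by rewrite mulr_gt0 // ltcR.
move=> u uv; apply/(gauge_lt1P u A0).
exists s; first by rewrite s0.
have -> : (s^-1)%:C *: u = (t / s)%:C *: ((t^-1)%:C *: v) +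
    (1 - t / s)%:C *: (((s - t)^-1)%:C *: (u - v)).
  rewrite !scalerA -!rmorphM /= mulrAC divff ?gt_eqF // mul1r.
  have -> : (1 - t / s) / (s - t) = s^-1 by field; rewrite !gt_eqF.
  by rewrite -scalerDr addrC subrK.
apply: convex_hull_convex ht _.
- by rewrite divr_ge0 // ltW.
- by rewrite ler_pdivrMr // mul1r ltW.
apply: (@sub_convex_hull n A); apply: eA; rewrite subr0 normrZ normc_real.
by rewrite gtr0_norm ?invr_gt0 // fmorphV ltr_pdivrMl // ltcR.
Qed.

End ConvexHull.

Section Busemann.
Variable R : realType.
Local Notation C := R[i].

Lemma affine_is_diff n (w b : 'rV[C]_n) (z : C) :
  is_diff z (fun t : C => t *: w + b) (fun t => t *: w).
Proof.
have H : is_diff z ( *:%R^~ w + cst b) ( *:%R^~ w + 0) by exact: is_diffD.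
apply: DiffDef; first exact: (@ex_diff _ _ _ _ _ _ _ H).
by rewrite (@diff_val _ _ _ _ _ _ _ H) addr0.
Qed.

(** For small [v], the affine disc [z |-> chart_at p p + 2 z v] stays in the image
    of the chart.  Its velocity [2 v] shows that the Kobayashi metric of [v] is
    at most one half. *)
Lemma kobayashi_near0 n (M : complex_manifold R n) (p : M) :
  \forall v \near (0 : 'rV[C]_n), kobayashi (v : tangent p) < 1.
Proof.
have : open_nbhs (chart_at p p) (chart_at p @` chart_dom (chart_at p)).
  split; first exact: chart_im_open.
  by exists p => //; exact: chart_at_dom.
move=> /open_nbhs_nbhs/nbhs_distP[e e0 eD].
apply/nbhs_distP; exists (e / 2); first by rewrite divr_gt0.
move=> v; rewrite subr0 => ve.
apply: (@le_lt_trans _ _ (2^-1)); last by lra.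
apply: ge_inf; first by exists 0 => _ [l [l0 _] <-]; rewrite invr_ge0 ltW.
exists 2 => //; split=> //.
pose a z : 'rV[C]_n := z *: (2 *: v) + chart_at p p.
have aD z : `|z| < 1 -> exists2 x, chart_dom (chart_at p) x & chart_at p x = a z.
  move=> z1; suff [x] : (chart_at p @` chart_dom (chart_at p)) (a z) by exists x.
  apply: eD; rewrite /a addrK !normrZ.
  rewrite normr_nat mulrCA; apply: le_lt_trans (_ : 2 * (1 * `|v|) < e).
    by rewrite ler_wpM2l // ler_wpM2r // ltW.
  by rewrite mul1r -ltr_pdivlMl // mulrC.
have da z : is_diff z a (fun t : C => t *: (2 *: v)) by exact: affine_is_diff.
have ac z : {for z, continuous a}.
  by apply: differentiable_continuous; have [] := da z.
exists (chart_inv (chart_at p) \o a); split.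
- move=> z /aD[x xD xa].
  have dz : (chart_inv (chart_at p) \o a) z = x by rewrite /= -xa chart_mapK.
  split.
    apply: continuous_comp; first exact: ac.
    by rewrite -xa; exact: chart_inv_continuous.
  rewrite dz compA; apply/derivable1_diffP/differentiable_comp.
    by have [] := da z.
  by rewrite -xa; apply: chart_transition => //; exact: chart_at_dom.
- by rewrite /= /a scale0r add0r chart_atK.
- rewrite /disc_velocity0 derive1E (@near_eq_derive _ _ _ _ a).
    rewrite deriveE; last by have [] := da 0.
    by rewrite (@diff_val _ _ _ _ _ _ _ (da 0)) scale1r rmorph_nat.
  have a0 : a 0 = chart_at p p by rewrite /a scale0r add0r.
  by have := ac 0; rewrite /prop_for /continuous_at a0 => /(_ _ (near_chart_invK p)).
Qed.

Lemma open_busemann_ball n (M : complex_manifold R n) (p : M) :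
  open (unit_ball (@kobayashi_busemann _ _ M p) : set 'rV[C]_n).
Proof. exact/open_unit_ball_gauge/kobayashi_near0. Qed.

Lemma busemann_covering m n (M : complex_manifold R m) (N : complex_manifold R n)
    (f : M -> N) (p : M) (v : tangent p) :
  holomorphic_covering f ->
  kobayashi_busemann (tangent_map f v) = kobayashi_busemann v.
Proof.
move=> f_cov; have [L [_ LK KL]] := tangent_map_inverse f_cov p.
pose T : {linear 'rV[C]_m -> 'rV[C]_n} := 'd (local_expr f p) (chart_at p p).
have hullT : convex_hull [set w : tangent p | kobayashi w < 1] `<=`
    T @^-1` convex_hull [set w : tangent (f p) | kobayashi w < 1].
  apply: convex_hull_linear => w /=.
  by rewrite -(kobayashi_covering f_cov).
have hullL : convex_hull [set w : tangent (f p) | kobayashi w < 1] `<=`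
    L @^-1` convex_hull [set w : tangent p | kobayashi w < 1].
  apply: convex_hull_linear => w /=.
  by rewrite -(kobayashi_covering f_cov) KL.
rewrite /kobayashi_busemann; congr inf; apply/seteqP.
split=> t [t0 ht]; split=> //.
  by have := hullL _ ht; rewrite /= linearZ /= LK.
by have := hullT _ ht; rewrite /= linearZ.
Qed.
End Busemann.

(** * Compact exhaustion and countable base of C^n *)

Section ComplexSpaceTopology.
Variables (R : realType).
Local Notation C := R[i].

Lemma normc_le_ReIm (z : C) : `|z| <= (`|complex.Re z| + `|complex.Im z|)%:C.
Proof.
rewrite {1}[z]complexE (le_trans (ler_normD _ _)) // rmorphD /= normc_real.
rewrite lerD2l normrM normc_real.
by rewrite (_ : `|'i%C| = 1) ?mul1r // normc_def /= expr0n expr1n add0r sqrtr1.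
Qed.

Lemma lipschitz1_continuous (V : normedModType C) (g : V -> R) :
  (forall x y, `|g x - g y|%:C <= `|x - y|) -> continuous g.
Proof.
move=> gl x; apply/cvgrPdist_lt => /= e e0; apply/nbhs_distP.
exists e%:C; first by rewrite ltcR.
by move=> y yx; rewrite -ltcR (le_lt_trans (gl _ _)) // distrC.
Qed.

Lemma Re_continuous : continuous (@complex.Re R : C -> R).
Proof.
apply: (@lipschitz1_continuous C) => x y.
rewrite (_ : complex.Re x - _ = complex.Re (x - y)); first exact: normc_ge_Re.
by case: x y => ? ? [].
Qed.

Lemma Im_continuous : continuous (@complex.Im R : C -> R).
Proof.
apply: (@lipschitz1_continuous C) => x y.
rewrite (_ : complex.Im x - _ = - complex.Re ((x - y) * 'i%C)); last first.
  by rewrite ReiNIm opprK; case: x y => ? ? [].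
rewrite normrN (le_trans (normc_ge_Re _)) // normrM.
by rewrite (_ : `|'i%C| = 1) ?mulr1 // normc_def /= expr0n expr1n add0r sqrtr1.
Qed.

Lemma complex_pair_continuous :
  continuous ((fun ab : R * R => ab.1 +i* ab.2) : R * R -> C).
Proof.
move=> [a b]; apply/cvgrPdist_lt => /= e e0.
have er := RRe_real (gtr0_real e0).
have e0' : 0 < complex.Re e / 2 by rewrite divr_gt0 // -ltcR er.
exists (ball a (complex.Re e / 2), ball b (complex.Re e / 2)).
  by split; apply: nbhsx_ballx.
move=> [c d] [/= ac bd]; rewrite (le_lt_trans (normc_le_ReIm _)) // -er ltcR /=.
by rewrite [ltRHS]splitr ltrD.
Qed.

(** Products of squares rather than of discs, so that compactness reduces to that
    of real segments. *)
Definition polydisc n (k : nat) : set 'rV[C]_n :=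
  [set v | forall i, [set ab.1 +i* ab.2 | ab in
    `[- k%:R, k%:R]%classic `*` `[- k%:R, k%:R]%classic] (v ord0 i)].

Lemma polydisc_compact n k : compact (@polydisc n k).
Proof.
apply: (@rV_compact C n (fun=> [set ab.1 +i* ab.2 | ab in
    `[- k%:R, k%:R]%classic `*` `[- k%:R, k%:R]%classic])) => _.
apply: continuous_compact.
  by apply: continuous_subspaceT; exact: complex_pair_continuous.
by apply: compact_setX; exact: segment_compact.
Qed.

Lemma polydisc_cover n : \bigcup_k (@polydisc n k) = setT.
Proof.
rewrite -subTset => v _.
pose s := \sum_i (`|complex.Re (v ord0 i)| + `|complex.Im (v ord0 i)|).
have sP i : `|complex.Re (v ord0 i)| + `|complex.Im (v ord0 i)| <= s.
  by rewrite /s (bigD1 i) //= lerDl sumr_ge0 // => j _; rewrite addr_ge0.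
exists (Num.truncn s).+1 => // i; exists (complex.Re (v ord0 i), complex.Im (v ord0 i)).
  have := truncnS_gt s; move: (sP i) => /= + ts.
  move: (normr_ge0 (complex.Re (v ord0 i))) (normr_ge0 (complex.Im (v ord0 i))).
  by split; rewrite /= in_itv /= -ler_norml; lra.
by case: (v ord0 i).
Qed.

Lemma polydisc_le n k l : (k <= l)%N -> @polydisc n k `<=` @polydisc n l.
Proof.
move=> kl v vk i; have [[a b] [/= ha hb] <-] := vk i; exists (a, b) => //.
have kl' : k%:R <= l%:R :> R by rewrite ler_nat.
by move: ha hb; rewrite !in_itv /= => /andP[? ?] /andP[? ?]; split;
  rewrite /= ?in_itv /=; apply/andP; split; lra.
Qed.

Definition rational_point n (q : 'rV[rat * rat]_n) : 'rV[C]_n :=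
  map_mx (fun ab => ratr ab.1 +i* ratr ab.2) q.

Lemma rational_point_dense n (x : 'rV[C]_n) (e : R) : 0 < e ->
  exists q, ball x e%:C (rational_point q).
Proof.
move=> e0; have e20 : 0 < e / 2 by rewrite divr_gt0.
have H (a : R) : exists q : rat, `|a - ratr q| < e / 2.
  have [|q] := @rat_in_itvoo R (a - e / 2) (a + e / 2); first by lra.
  by rewrite in_itv /= => /andP[? ?]; exists q; rewrite ltr_norml; apply/andP; split; lra.
have [q qP] := choice H.
exists (map_mx (fun z => (q (complex.Re z), q (complex.Im z))) x).
split; first by rewrite ltcR.
move=> i j; rewrite !mxE -ball_normE /= (le_lt_trans (normc_le_ReIm _)) // ltcR.
case: (x i j) => a b /=; rewrite [ltRHS]splitr ltrD //; exact: qP.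
Qed.

Lemma rational_ball_base n (O : set 'rV[C]_n) (x : 'rV[C]_n) : nbhs x O ->
  exists q k, let B := ball (rational_point q) (k.+1%:R^-1 : R)%:C in
    B x /\ B `<=` O.
Proof.
move=> /nbhs_ballP[e /= e0 eO].
have er := RRe_real (gtr0_real e0).
have e0' : 0 < complex.Re e / 2 by rewrite divr_gt0 // -ltcR er.
pose k := Num.truncn ((complex.Re e / 2)^-1).
have k0 : 0 < k.+1%:R^-1 :> R by rewrite invr_gt0.
have ke : k.+1%:R^-1 < complex.Re e / 2.
  by rewrite invf_plt ?posrE //; exact: truncnS_gt.
have [q xq] := rational_point_dense x k0.
exists q, k => /=; split; first exact: ball_sym.
move=> y qy; apply: eO; apply: le_ball (ball_triangle xq qy).
rewrite -rmorphD -[leRHS]er lecR /=; move: ke; set r := _.+1%:R^-1; lra.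
Qed.

End ComplexSpaceTopology.

(** * Uniqueness of Haar measures *)

Section Borel.
Variables (R : realType).
Local Notation C := R[i].
Local Notation V n := ('rV[C]_n).

Lemma borel_open n (A : set (V n)) :
  open A -> measurable (A : set (borel_space R n)).
Proof. exact: sub_sigma_algebra. Qed.

Lemma borel_compact n (A : set (V n)) :
  compact A -> measurable (A : set (borel_space R n)).
Proof.
move=> Ac; rewrite -[A]setCK; apply: measurableC; apply: borel_open.
apply: (@closed_openC (V n)); apply: (@compact_closed (V n)) => //.
Qed.

Lemma continuous_borel m n (h : V m -> V n) : continuous h ->
  measurable_fun setT (h : borel_space R m -> borel_space R n).
Proof.
move=> hc; apply: (@measurability _ _ (borel_space R m) (borel_space R n) setT h
  (@open (V n))) => // _ [B oB <-].
by rewrite setTI; apply: borel_open; apply: open_comp => // x _; exact: hc.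
Qed.

Lemma continuous_borel_real n (h : V n -> R) : continuous h ->
  measurable_fun setT (h : borel_space R n -> R).
Proof.
move=> hc; apply: (measurability _ (RGenOInfty.measurableE R)) => _ [B [x ->] <-].
rewrite setTI; apply: borel_open; apply: open_comp => [y _|]; first exact: hc.
exact: interval_open.
Qed.

(** Borel sets of the product are measurable for the product sigma-algebra
    because an open set is the union of countably many products of balls with
    rational centres and radii [1 / (k + 1)]. *)
Lemma borel_prod_open n (O : set (V n * V n)) : open O ->
  measurable (O : set (borel_space R n * borel_space R n)).
Proof.
move=> oO.
pose B (i : 'rV[rat * rat]_n * nat) : set (V n) :=
  ball (rational_point R i.1) (i.2.+1%:R^-1 : R)%:C.
pose F (i : ('rV[rat * rat]_n * nat) * ('rV[rat * rat]_n * nat)) : set (V n * V n) :=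
  [set x | B i.1 `*` B i.2 `<=` O /\ (B i.1 `*` B i.2) x].
have -> : O = \bigcup_i F i.
  apply/seteqP; split=> [[x y] Oxy|z [i _ [BO /BO]]//].
  have [[A1 A2] /= [xA yA] AO] : nbhs (x, y) O by apply: open_nbhs_nbhs.
  have [q [k [xB BA1]]] := rational_ball_base xA.
  have [r [l [yB BA2]]] := rational_ball_base yA.
  exists ((q, k), (r, l)) => //; split=> // -[u w] [/= /BA1 ? /BA2 ?].
  exact: AO.
apply: countable_bigcupT_measurable => [|i]; first exact: countableP.
have [BO|nBO] := pselect (B i.1 `*` B i.2 `<=` O); last first.
  by rewrite (_ : F i = set0) //; apply/seteqP; split=> x // [].
rewrite (_ : F i = B i.1 `*` B i.2); last first.
  by apply/seteqP; split=> x //; case.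
by apply: measurableX; apply: borel_open; exact: ball_open.
Qed.

Lemma continuous_borel_prod n (h : V n * V n -> V n) : continuous h ->
  measurable_fun setT (h : borel_space R n * borel_space R n -> borel_space R n).
Proof.
move=> hc; apply: (@measurability _ _ (borel_space R n * borel_space R n)%type
  (borel_space R n) setT h (@open (V n))) => // _ [B oB <-].
by rewrite setTI; apply: borel_prod_open; apply: open_comp => // x _; exact: hc.
Qed.

End Borel.

Section HaarUniqueness.
Variables (R : realType) (n : nat).
Local Notation C := R[i].
Local Notation V := ('rV[C]_n).
Local Notation B := (borel_space R n).

Lemma haar_sigma_finite (mu : haar_measure R n) : sigma_finite setT mu.
Proof.
exists (@polydisc R n); first by rewrite polydisc_cover.
move=> k; split; first by apply: borel_compact; exact: polydisc_compact.
by apply: haar_compact; exact: polydisc_compact.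
Qed.

(** A bare set function, on which the structure of sigma-finite measure that
    Fubini's theorem requires can be declared. *)
Definition haar_set (mu : haar_measure R n) : set B -> \bar R := mu.

HB.instance Definition _ (mu : haar_measure R n) := Measure.on (haar_set mu).

HB.instance Definition _ (mu : haar_measure R n) :=
  Measure_isSigmaFinite.Build _ B R (haar_set mu) (haar_sigma_finite mu).

Lemma haar_shift (mu : haar_measure R n) (v : V) (A : set B) :
  measurable A -> mu [set x : V | A (x + v)] = mu A.
Proof.
move=> mA; rewrite -[RHS](haar_translation mu (- v) mA); congr (mu _).
apply/seteqP; split=> [x Axv|_ [x Ax <-]] /=; last by rewrite addrAC addNr add0r.
by exists (x + v) => //; rewrite addrC addrK.
Qed.

Lemma measurable_continuous_preimage (A : set B) (h : V * V -> V) :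
  measurable A -> continuous h ->
  measurable [set z : B * B | A (h z)].
Proof.
move=> mA hc; have := continuous_borel_prod hc measurableT mA.
by rewrite setTI.
Qed.

(** The measure of [(x, y) | X x, Y (x + y)] is [mu X * nu Y] when integrating
    first in [y].  Integrating first in [x], after the translation of [x] by [- y],
    turns that set into [(x, y) | Y x, X (x - y)], whose measure is
    [mu Y * nu (- X)] when [y] is again integrated first. *)
Lemma haar_exchange (mu nu : haar_measure R n) (X Y : set B) :
  measurable X -> measurable Y ->
  (mu X * nu Y = mu Y * nu [set x : V | X (- x)%R])%E.
Proof.
move=> mX mY.
have cadd : continuous (fun z : V * V => z.1 + z.2).
  by move=> z; apply: cvgD; [exact: cvg_fst|exact: cvg_snd].
have csub : continuous (fun z : V * V => z.1 - z.2).
  by move=> z; apply: cvgB; [exact: cvg_fst|exact: cvg_snd].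
have mNX : measurable ([set x : V | X (- x)] : set B).
  have copp : continuous (fun z : V => - z).
    exact: opp_continuous.
  have := continuous_borel copp measurableT mX.
  by rewrite setTI.
pose E1 : set (B * B) := X `*` setT `&` [set z : B * B | Y ((z.1 : V) + z.2)].
pose E2 : set (B * B) := Y `*` setT `&` [set z : B * B | X ((z.1 : V) - z.2)].
have mE1 : measurable E1.
  apply: measurableI; first exact: measurableX.
  exact: (measurable_continuous_preimage mY cadd).
have mE2 : measurable E2.
  apply: measurableI; first exact: measurableX.
  exact: (measurable_continuous_preimage mX csub).
have F E (mE : measurable E) :
    (\int[mu]_x nu (xsection E x) = \int[nu]_y mu (ysection E y))%E.
  have := indic_fubini_tonelli (haar_set mu) (haar_set nu) mE.
  by rewrite indic_fubini_tonelli_FE // indic_fubini_tonelli_GE.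
have I (la : haar_measure R n) (Z : set B) (c : \bar R) : measurable Z -> (0 <= c)%E ->
    (\int[la]_x ((\1_Z x)%:E * c) = la Z * c)%E.
  move=> mZ c0; rewrite ge0_integralZr ?integral_indic ?setIT //.
  by apply/measurable_EFinP; exact: measurable_indic.
have xE (E : set (B * B)) x y : xsection E x y = E (x, y) by rewrite /xsection /= inE.
have yE (E : set (B * B)) x y : ysection E y x = E (x, y) by rewrite /ysection /= inE.
transitivity (\int[mu]_x nu (xsection E1 x))%E.
  rewrite -I //; apply: eq_integral => x _; rewrite indicE.
  have [xX|xX] := boolP (x \in X); rewrite ?mul1e ?mul0e.
    rewrite -(haar_shift nu x mY); congr (nu _).
    apply/seteqP; split=> y; rewrite xE /E1 /= (addrC y).
      by move=> Yy; split=> //; split=> //; rewrite -inE.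
    by case.
  rewrite (_ : xsection E1 x = set0) ?measure0 //.
  apply/seteqP; split=> y //; rewrite xE => -[[Xx _] _].
  by move: xX; rewrite (mem_set Xx).
rewrite F //; transitivity (\int[nu]_y mu (ysection E2 y))%E.
  apply: eq_integral => y _; rewrite -(haar_shift mu y (measurable_ysection y mE2)).
  congr (mu _); apply/seteqP; split=> x; rewrite /= !yE /E1 /E2 /= addrK.
    by move=> [[? _] ?].
  by move=> [[? _] ?].
rewrite -F // -I //; apply: eq_integral => x _; rewrite indicE.
have [xY|xY] := boolP (x \in Y); rewrite ?mul1e ?mul0e.
  rewrite -(haar_shift nu (- x) mNX); congr (nu _).
  apply/seteqP; split=> y; rewrite /= xE /E2 /= opprB.
    by case.
  by move=> Xy; split=> //; split=> //; rewrite -inE.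
rewrite (_ : xsection E2 x = set0) ?measure0 //.
apply/seteqP; split=> y //; rewrite xE => -[[Yx _] _].
by move: xY; rewrite (mem_set Yx).
Qed.

(** If all polydiscs were null sets, so would be the whole space, which is their
    union. *)
Lemma haar_polydisc_gt0 (mu : haar_measure R n) :
  exists k, forall l, (k <= l)%N -> (0 < mu (@polydisc R n l))%E.
Proof.
suff [k k0] : exists k, (0 < mu (@polydisc R n k))%E.
  exists k => l kl; apply: lt_le_trans k0 _; apply: le_measure.
  - by rewrite inE; apply: borel_compact; exact: polydisc_compact.
  - by rewrite inE; apply: borel_compact; exact: polydisc_compact.
  - exact: polydisc_le.
apply: contrapT => /forallNP H; apply: (@haar_neq0 _ _ mu).
rewrite -polydisc_cover; apply/eqP; rewrite eq_le measure_ge0 andbT.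
have m0 k : mu (@polydisc R n k) = 0%E.
  by apply/eqP; rewrite eq_le measure_ge0 andbT leNgt; apply/negP/H.
have mP k : measurable (@polydisc R n k : set B).
  by apply: borel_compact; exact: polydisc_compact.
apply: (le_trans (measure_sigma_subadditive mu mP _ (subset_refl _))).
  exact: bigcup_measurable.
  exact: subset_refl.
by rewrite eseries0 // => i _ _; exact: m0.
Qed.

(** With [nu] in place of [mu], [haar_exchange] gives [nu (- A) = nu A]; then the
    exchange formula says that [mu A * nu K = mu K * nu A], where [K] is a large
    compact polydisc. *)
Lemma haar_unique (mu nu : haar_measure R n) :
  exists2 c : R, 0 < c & forall A : set B, measurable A -> mu A = (c%:E * nu A)%E.
Proof.
have [k kP] := haar_polydisc_gt0 mu; have [l lP] := haar_polydisc_gt0 nu.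
pose K := @polydisc R n (maxn k l).
have Kc : compact K by exact: polydisc_compact.
have mK : measurable (K : set B) by exact: borel_compact.
have muK := kP _ (leq_maxl k l); have nuK := lP _ (leq_maxr k l).
have muKoo := haar_compact mu Kc; have nuKoo := haar_compact nu Kc.
rewrite -/K in muK nuK.
have muKf : mu K \is a fin_num by rewrite ge0_fin_numE ?measure_ge0.
have nuKf : nu K \is a fin_num by rewrite ge0_fin_numE ?measure_ge0.
have cancel (x y z : \bar R) : x \is a fin_num -> (0 < x)%E -> (x * y = x * z)%E -> y = z.
  by move=> xf x0 e; apply/le_anti/andP; split; rewrite -(lee_pmul2l xf x0) e.
have nuN (A : set B) : measurable A -> nu [set x : V | A (- x)] = nu A.
  move=> mA; apply: (cancel _ _ _ nuKf nuK).
  by rewrite -(haar_exchange nu nu mA mK) muleC.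
exists (fine (mu K) / fine (nu K)).
  by rewrite divr_gt0 // fine_gt0 // ?muK ?nuK.
move=> A mA; apply: (cancel (nu K)) => //.
rewrite muleC (haar_exchange mu nu mA mK) nuN // muleA; congr (_ * _)%E.
rewrite -{1}(fineK muKf) -{1}(fineK nuKf) -EFinM mulrCA divff ?mulr1 //.
by rewrite gt_eqF // fine_gt0 // nuK.
Qed.

End HaarUniqueness.

(** * Change of variables in the form on the dual *)

Lemma fine_pscale (R : realType) (c : R) (x : \bar R) :
  0 < c -> fine (c%:E * x)%E = c * fine x.
Proof.
move=> c0; case: x => [a| |] //.
- by rewrite mulry gtr0_sg // mul1e /= mulr0.
- by rewrite mulrNy gtr0_sg // mul1e /= mulr0.
Qed.

(** The case of two infinite values is included: [+oo - +oo] is [-oo], and [fine]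
    sends all infinite values to [0]. *)
Lemma fine_pscaleB (R : realType) (c : R) (x y : \bar R) :
  0 < c -> (0 <= x)%E -> (0 <= y)%E ->
  fine (c%:E * x - c%:E * y)%E = c * fine (x - y)%E.
Proof.
move=> c0; case: x y => [a| |] [b| |] // _ _.
- by rewrite /= mulrBr.
- by rewrite mulry gtr0_sg // mul1e /= mulr0.
- by rewrite mulry gtr0_sg // mul1e /= mulr0.
- by rewrite mulry gtr0_sg // mul1e /= mulr0.
Qed.

Section Transport.
Variables (R : realType) (n : nat).
Local Notation C := R[i].
Local Notation V := ('rV[C]_n).
Local Notation B := (borel_space R n).

Lemma dual_continuous (t : dual R n) : continuous (t : V -> C).
Proof.
have -> : (t : V -> C) = (fun v => \sum_j v ord0 j * t (delta_mx ord0 j)).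
  apply/funext => v; rewrite {1}[v]row_sum_delta linear_sum.
  by apply: eq_bigr => j _; rewrite linearZ.
elim: (index_enum _) => [|j r IH].
  by under eq_fun do rewrite big_nil; exact: cst_continuous.
under eq_fun do rewrite big_cons.
move=> v; apply: (@continuousD C C^o V (fun v => v ord0 j * t (delta_mx ord0 j)));
  last exact: IH.
by apply: (@cvgMr_tmp C V (nbhs v)); exact: coord_continuous.
Qed.

Lemma dual_product_Re_continuous (s t : dual R n) :
  continuous ((fun x => complex.Re (s x * (t x)^*)) : V -> R).
Proof.
have -> : (fun x : V => complex.Re (s x * (t x)^*)) = (fun x : V =>
    complex.Re (s x) * complex.Re (t x) + complex.Im (s x) * complex.Im (t x)).
  by apply/funext => x; case: (s x) (t x) => a b [c d] /=; rewrite mulrN opprK.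
move=> x.
have c (u : dual R n) : {for x, continuous (fun y : V => complex.Re (u y))}.
  by apply: continuous_comp; [exact: dual_continuous|exact: Re_continuous].
have c' (u : dual R n) : {for x, continuous (fun y : V => complex.Im (u y))}.
  by apply: continuous_comp; [exact: dual_continuous|exact: Im_continuous].
exact: (continuousD (continuousM (c s) (c t)) (continuousM (c' s) (c' t))).
Qed.

Lemma dual_product_Im_continuous (s t : dual R n) :
  continuous ((fun x => complex.Im (s x * (t x)^*)) : V -> R).
Proof.
have -> : (fun x : V => complex.Im (s x * (t x)^*)) = (fun x : V =>
    complex.Im (s x) * complex.Re (t x) - complex.Re (s x) * complex.Im (t x)).
  by apply/funext => x; case: (s x) (t x) => a b [c d] /=; rewrite mulrN addrC.
move=> x.
have c (u : dual R n) : {for x, continuous (fun y : V => complex.Re (u y))}.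
  by apply: continuous_comp; [exact: dual_continuous|exact: Re_continuous].
have c' (u : dual R n) : {for x, continuous (fun y : V => complex.Im (u y))}.
  by apply: continuous_comp; [exact: dual_continuous|exact: Im_continuous].
exact: (continuousB (continuousM (c' s) (c t)) (continuousM (c s) (c' t))).
Qed.

Variables (T S : {linear V -> V}).
Hypotheses (T_cont : continuous T) (S_cont : continuous S).
Hypotheses (TK : cancel T S) (SK : cancel S T).

Lemma measurable_linear_preimage (A : set B) :
  measurable A -> measurable (T @^-1` A : set B).
Proof.
by move=> mA; have := continuous_borel T_cont measurableT mA; rewrite setTI.
Qed.

Lemma pushforward_haar (mu : haar_measure R n) : exists la : haar_measure R n,
  forall A : set B, la A = mu (T @^-1` A).
Proof.
have [la laE] : exists la : {measure set B -> \bar R},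
    forall A : set B, la A = mu (T @^-1` A).
  unshelve refine (ex_intro _
    (pushforward mu (T : B -> B) : {measure set B -> \bar R}) _).
    exact: continuous_borel.
  by [].
have trans (v : V) (A : set B) : measurable A -> la [set v + x | x in A] = la A.
  move=> mA; rewrite !laE -(haar_translation mu (S v) (measurable_linear_preimage mA)).
  congr (mu _); apply/seteqP; split=> [x [y Ay yx]|_ [x Ax <-]] /=.
    exists (S y); first by rewrite /= SK.
    by rewrite -linearD yx TK.
  by exists (T x) => //; rewrite linearD SK.
have comp (K : set V) : compact K -> (la K < +oo)%E.
  move=> Kc; rewrite laE; apply: haar_compact.
  rewrite (_ : T @^-1` K = S @` K); last first.
    by apply/seteqP; split=> [x Kx|_ [y Ky <-]]; [exists (T x)|rewrite /= SK].
  by apply: continuous_compact Kc; exact: continuous_subspaceT.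
have neq0 : la setT <> 0%E by rewrite laE preimage_setT; exact: haar_neq0.
by exists (HaarMeasure trans comp neq0).
Qed.

(** The image of [mu] under [T] is again a Haar measure. *)
Lemma haar_linear (mu nu : haar_measure R n) : exists2 c : R, 0 < c &
  forall A : set B, measurable A -> mu (T @^-1` A) = (c%:E * nu A)%E.
Proof.
have [la laE] := pushforward_haar mu; have [c c0 cE] := haar_unique la nu.
by exists c => // A mA; rewrite -laE cE.
Qed.

Variables (mu nu : haar_measure R n) (c : R).
Hypotheses (c_gt0 : 0 < c)
  (c_scale : forall A : set B, measurable A -> mu (T @^-1` A) = (c%:E * nu A)%E).

Lemma ge0_integral_linear (D : set B) (g : B -> \bar R) :
  measurable D -> measurable_fun setT g -> (forall x, (0 <= g x)%E) ->
  (\int[mu]_(x in (T @^-1` D : set B)) g (T x) = c%:E * \int[nu]_(x in D) g x)%E.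
Proof.
move=> mD mg g0.
have mT : measurable_fun setT (T : B -> B) by exact: continuous_borel.
have mgD : measurable_fun D g by exact: measurable_funS mg.
rewrite -[LHS](@ge0_integral_pushforward _ _ B B _ (T : B -> B) mT mu D g mD mgD) //.
rewrite (_ : c%:E = (NngNum (ltW c_gt0))%:num%:E)%E //.
rewrite -ge0_integral_mscale //.
have [la laE] := pushforward_haar mu.
have -> : pushforward mu (T : B -> B) = la :> (set B -> \bar R).
  by apply/funext => A; rewrite laE.
by apply: eq_measure_integral => A mA _; rewrite laE c_scale.
Qed.

(** The positive and the negative part of [g] are transformed separately, as
    nonnegative functions. *)
Lemma Rintegral_linear (D : set B) (g : V -> R) :
  measurable D -> continuous g ->
  \int[mu]_(x in (T @^-1` D : set B)) g (T x) = c * \int[nu]_(x in D) g x.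
Proof.
move=> mD gc; have mg := continuous_borel_real gc.
have mg' : measurable_fun setT (fun x : B => (g x)%:E) by exact/measurable_EFinP.
rewrite /Rintegral integralE [in RHS]integralE.
have gT : (fun x : B => (g (T x))%:E) = (fun x : B => (g x)%:E) \o (T : B -> B) by [].
have -> : (\int[mu]_(x in (T @^-1` D : set B)) (fun x : B => (g (T x))%:E)^\+ x =
    c%:E * \int[nu]_(x in D) (fun x : B => (g x)%:E)^\+ x)%E.
  rewrite gT funepos_comp; apply: ge0_integral_linear => //.
  exact: measurable_funepos.
have -> : (\int[mu]_(x in (T @^-1` D : set B)) (fun x : B => (g (T x))%:E)^\- x =
    c%:E * \int[nu]_(x in D) (fun x : B => (g x)%:E)^\- x)%E.
  rewrite gT funeneg_comp; apply: ge0_integral_linear => //.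
  exact: measurable_funeneg.
by apply: fine_pscaleB => //; exact: integral_ge0.
Qed.

Lemma cintegral_linear (D : set B) (s t : dual R n) : measurable D ->
  cintegral mu (T @^-1` D) (fun x => s (T x) * (t (T x))^*) =
  c%:C * cintegral nu D (fun x => s x * (t x)^*).
Proof.
move=> mD; rewrite /cintegral.
rewrite (Rintegral_linear mD (@dual_product_Re_continuous s t)).
rewrite (Rintegral_linear mD (@dual_product_Im_continuous s t)).
by apply/eqP; rewrite eq_complex /= !mul0r subr0 addr0 !eqxx.
Qed.

Lemma dual_form_linear (F G : V -> R) (s t : dual R n) :
  open (unit_ball G) -> (forall v, G (T v) = F v) ->
  dual_form mu F (s \o linfun T)%VF (t \o linfun T)%VF = dual_form nu G s t.
Proof.
move=> oG GF.
have mG : measurable (unit_ball G : set B) by exact: borel_open.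
have FG : unit_ball F = T @^-1` unit_ball G.
  by apply/seteqP; split=> v; rewrite /unit_ball /= GF.
rewrite /dual_form FG c_scale //.
rewrite (_ : (fun x => _) = (fun x => s (T x) * (t (T x))^*)); last first.
  by apply/funext => x; rewrite !comp_lfunE !lfunE.
rewrite cintegral_linear // mulrA; congr (_ * _).
rewrite -rmorphM /=; congr (_%:C).
rewrite fine_pscale //.
by rewrite invfM mulrA mulrAC divfK // gt_eqF.
Qed.

End Transport.

(** * Representatives and naturality of the Binet-Legendre form *)

Section Riesz.
Variables (R : realType) (n : nat).
Local Notation C := R[i].
Local Notation V := ('rV[C]_n).
Local Notation B := (borel_space R n).
Variables (mu : haar_measure R n) (F : V -> R).

(** If both parts of [g] have infinite integral, both sides are [0]. *)
Lemma RintegralN (D : set B) (g : B -> R) :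
  \int[mu]_(x in D) - g x = - \int[mu]_(x in D) g x.
Proof.
rewrite /Rintegral integralE [in RHS]integralE.
have -> : (fun x => (- g x)%:E)^\+%E = (fun x => (g x)%:E)^\-%E :> (B -> \bar R).
  exact: (funeposN (fun x : B => (g x)%:E)).
have -> : (fun x => (- g x)%:E)^\-%E = (fun x => (g x)%:E)^\+%E :> (B -> \bar R).
  exact: (funenegN (fun x : B => (g x)%:E)).
move: (\int[mu]_(x in D) (fun x : B => (g x)%:E)^\- x)%E => [a| |];
  move: (\int[mu]_(x in D) (fun x : B => (g x)%:E)^\+ x)%E => [b| |] //=;
  by rewrite ?oppr0 ?opprB.
Qed.

Lemma dual_formC (s t : dual R n) : dual_form mu F s t = (dual_form mu F t s)^*.
Proof.
have reE : \int[mu]_(x in (unit_ball F : set B)) complex.Re (s x * (t x)^*) =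
    \int[mu]_(x in (unit_ball F : set B)) complex.Re (t x * (s x)^*).
  by apply: eq_Rintegral => x _; case: (s x) (t x) => a b [a' b'] /=; ring.
have imE : \int[mu]_(x in (unit_ball F : set B)) complex.Im (s x * (t x)^*) =
    - \int[mu]_(x in (unit_ball F : set B)) complex.Im (t x * (s x)^*).
  rewrite -RintegralN; apply: eq_Rintegral => x _.
  by case: (s x) (t x) => a b [a' b'] /=; ring.
rewrite /dual_form /cintegral reE imE; apply/eqP.
by rewrite eq_complex /= !mul0r !subr0 !addr0 mulrN !eqxx.
Qed.

Lemma dual_form0l (t : dual R n) : dual_form mu F 0 t = 0.
Proof.
have z : \int[mu]_(x in (unit_ball F : set B)) 0 = 0 by rewrite /Rintegral integral0.
have reE : \int[mu]_(x in (unit_ball F : set B))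
    complex.Re ((0 : dual R n) x * (t x)^*) = 0.
  by rewrite -[RHS]z; apply: eq_Rintegral => x _; rewrite lfunE /= mul0r.
have imE : \int[mu]_(x in (unit_ball F : set B))
    complex.Im ((0 : dual R n) x * (t x)^*) = 0.
  by rewrite -[RHS]z; apply: eq_Rintegral => x _; rewrite lfunE /= mul0r.
by rewrite /dual_form /cintegral reE imE mulr0.
Qed.

Definition represents (v : V) (t : dual R n) : Prop :=
  forall phi : dual R n, dual_form mu F phi t = phi v.

(** Two elements [t] and [t'] that represent [w] satisfy [t v = t' v] as soon as
    some [s] represents [v]: both are equal to the conjugate of [s w], by
    Hermitian symmetry of the form. *)
Lemma binet_legendre_eq (v w : V) (s t : dual R n) :
  represents v s -> represents w t -> binet_legendre mu F v w = t v.
Proof.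
move=> sv tw.
have rv : represents v (riesz mu F v) by apply: (xgetPex 0); exists s.
have rw : represents w (riesz mu F w) by apply: (xgetPex 0); exists t.
by rewrite /binet_legendre dual_formC rw -tw -dual_formC rv.
Qed.

(** The choice operator then returns the zero form for [v] or for [w]. *)
Lemma binet_legendre_eq0 (v w : V) :
  ~ (exists s, represents v s) \/ ~ (exists t, represents w t) ->
  binet_legendre mu F v w = 0.
Proof.
have r0 u : ~ (exists s, represents u s) -> riesz mu F u = 0.
  by move=> nu; apply: xgetPN => t tu; apply: nu; exists t.
by case=> /r0 E; rewrite /binet_legendre E ?dual_form0l // dual_formC dual_form0l rmorph0.
Qed.

End Riesz.

Section Naturality.
Variables (R : realType) (n : nat).
Local Notation C := R[i].
Local Notation V := ('rV[C]_n).

(** Composition with [T] and with its inverse exchanges the elements that represent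
    [v] for [F] and those that represent [T v] for [G]; in particular both
    exist or neither does. *)
Lemma binet_legendre_linear (T S : {linear V -> V}) (mu nu : haar_measure R n)
    (F G : V -> R) (v w : V) :
  continuous T -> continuous S -> cancel T S -> cancel S T ->
  open (unit_ball G) -> (forall v, G (T v) = F v) ->
  binet_legendre nu G (T v) (T w) = binet_legendre mu F v w.
Proof.
move=> Tc Sc TK SK oG GF.
have [c c0 cE] := haar_linear Tc Sc TK SK mu nu.
have dE s t := dual_form_linear Tc Sc TK SK c0 cE s t oG GF.
have pull u s : represents nu G (T u) s -> represents mu F u (s \o linfun T)%VF.
  move=> us phi; have -> : phi = (phi \o linfun S \o linfun T)%VF.
    by apply/lfunP => x; rewrite !comp_lfunE !lfunE /= TK.
  by rewrite dE us !comp_lfunE !lfunE.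
have push u t : represents mu F u t -> represents nu G (T u) (t \o linfun S)%VF.
  move=> ut phi; rewrite -dE.
  have -> : ((t \o linfun S) \o linfun T)%VF = t.
    by apply/lfunP => x; rewrite !comp_lfunE !lfunE /= TK.
  by rewrite ut !comp_lfunE !lfunE.
have [[s vs]|nv] := pselect (exists s, represents mu F v s); last first.
  rewrite !binet_legendre_eq0 //; left => // -[s /pull vs]; apply: nv.
  by exists (s \o linfun T)%VF.
have [[t wt]|nw] := pselect (exists t, represents mu F w t); last first.
  rewrite !binet_legendre_eq0 //; right => // -[t /pull wt]; apply: nw.
  by exists (t \o linfun T)%VF.
rewrite (binet_legendre_eq vs wt) (binet_legendre_eq (push _ _ vs) (push _ _ wt)).
by rewrite comp_lfunE lfunE /= TK.
Qed.
End Naturality.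

Theorem theorem1p3 (R : realType) (m n : nat) (m_gt0 : (0 < m)%N)
    (n_gt0 : (0 < n)%N)
    (M : complex_manifold R m) (N : complex_manifold R n)
    (muM : M -> haar_measure R m) (muN : N -> haar_measure R n)
    (f : M -> N)
    (M_hyp : kobayashi_hyperbolic M) (N_hyp : kobayashi_hyperbolic N)
    (f_cov : holomorphic_covering f) :
  forall (p : M) (v w : tangent p),
    kappa muN (tangent_map f v) (tangent_map f w) = kappa muM v w.
Proof.
move=> p v w; have mn := covering_dim f_cov p; subst n.
have [L [Lc LK KL]] := tangent_map_inverse f_cov p.
apply: (@binet_legendre_linear R m ('d (local_expr f p) (chart_at p p)) L).
- exact: tangent_map_continuous.
- exact: Lc.
- exact: LK.
- exact: KL.
- exact: open_busemann_ball.
- by move=> u; exact: busemann_covering.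
Qed.
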